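(* Let $\mathbb{X}$ be an $n$-dimensional real Banach space. Then there exists an element $z\in Ext(B_\mathbb{X})$ such that $\Gamma(\mathbb{X})=\rho'(z,w)$ for some $w\in S_\mathbb{X}$ with $z\perp_B w$.
   Context: All normed spaces are real; $B_\mathbb{X}$ and $S_\mathbb{X}$ are the closed unit ball and the unit sphere of $\mathbb{X}$, and $Ext(C)$ is the set of extreme points of a convex set $C$. Birkhoff-James orthogonality: $x\perp_B y$ means $\|x+\lambda y\|\ge\|x\|$ for all $\lambda\in\mathbb{R}$. Norm derivatives: $\rho'_{\pm}(x,y)=\|x\|\lim_{t\to 0^{\pm}}\frac{\|x+ty\|-\|x\|}{t}$ and $\rho'(x,y)=\frac12(\rho'_+(x,y)+\rho'_-(x,y))$. The constant $\Gamma(\mathbb{X})$ is defined by $\Gamma(\mathbb{X})=\sup\{|\rho'(x,y)|: x,y\in S_\mathbb{X},\ x\perp_B y\}$.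
   Formalization: The dimension n is assumed to be at least 2; for n at most 1 there are no Birkhoff-James orthogonal unit vectors, so the supremum defining Γ(X) is over the empty set and no such w exists. *)

(* Defs.v *)
From HB Require Import structures.
From mathcomp Require Import all_boot all_order all_algebra.
From mathcomp Require Import all_classical all_reals all_analysis.
Import Order.TTheory GRing.Theory Num.Theory.
Import numFieldNormedType.Exports.

Set Implicit Arguments.
Unset Strict Implicit.
Unset Printing Implicit Defensive.

Local Open Scope classical_set_scope.
Local Open Scope ring_scope.

Definition unit_ball (R : realType) (X : normedModType R) : set X :=
  [set x | `|x| <= 1].

Definition unit_sphere (R : realType) (X : normedModType R) : set X :=
  [set x | `|x| = 1].

Definition extreme_points (R : realType) (X : lmodType R) (C : set X) : set X :=
  [set z | C z /\
    forall (x y : X) (t : R), C x -> C y -> 0 < t < 1 ->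
      z = t *: x + (1 - t) *: y -> x = z /\ y = z].

Definition bj_orthogonal (R : realType) (X : normedModType R) (x y : X) : Prop :=
  forall l : R, `|x| <= `|x + l *: y|.

(* The difference quotient is monotone in t and bounded by `|y|, so both
   one-sided limits exist and [lim] never takes its default value. *)
Definition rho_plus (R : realType) (X : normedModType R) (x y : X) : R :=
  `|x| * lim ((`|x + t *: y| - `|x|) / t @[t --> 0^'+]).

Definition rho_minus (R : realType) (X : normedModType R) (x y : X) : R :=
  `|x| * lim ((`|x + t *: y| - `|x|) / t @[t --> 0^'-]).

Definition rho (R : realType) (X : normedModType R) (x y : X) : R :=
  (rho_plus x y + rho_minus x y) / 2.

(* The set lies in [0, 1], and it is nonempty as soon as dim X >= 2, so that
   [sup] is then a genuine supremum. In dimension at most 1 the set is empty. *)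
Definition Gamma (R : realType) (X : normedModType R) : R :=
  sup [set r | exists x y : X,
    [/\ unit_sphere x, unit_sphere y, bj_orthogonal x y & r = `|rho x y|]].
Arguments Gamma {R} X.

(* Main.v *)
From HB Require Import structures.
Require Import Defs.
From mathcomp Require Import all_boot all_order all_algebra.
From mathcomp Require Import all_classical all_reals all_analysis.
From mathcomp Require Import ring lra.
Import Order.TTheory GRing.Theory Num.Theory.
Import numFieldNormedType.Exports.

Local Open Scope classical_set_scope.
Local Open Scope ring_scope.

(* For a unit vector x, the condition [r <= rho_plus x y] says that
   [1 + s * r <= `|x + s *: y|] for all [s >= 0]. It is closed in (x, y, r), so
   the supremum r of [rho_plus x y] over orthogonal unit pairs is attained; and
   if it holds at a proper convex combination of points of the unit ball, it
   holds at both end points, so (for fixed y) x can be moved to an extreme point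
   z of the ball. Tilting y towards z until [rho_minus] vanishes gives w with
   [r / 2 <= rho z w], while [`|rho x y| <= r / 2] for every orthogonal pair,
   because there [rho_minus x y <= 0 <= rho_plus x y]. *)

(** * One-sided norm derivatives *)

Section NormDerivatives.
Context {R : realType} {X : normedModType R}.
Implicit Types (x y z w : X) (r s t : R).

(** Convexity of the norm: [x + s *: y] is the convex combination of [x] and [x + t *: y] in which
    the latter has weight [s / t]. *)
Lemma diffquo_le x y s t : 0 < s -> s <= t ->
  (`|x + s *: y| - `|x|) / s <= (`|x + t *: y| - `|x|) / t.
Proof.
move=> s0 st; have t0 : 0 < t by exact: lt_le_trans st.
have a0 : 0 <= s / t by rewrite divr_ge0 ?ltW.
have a1 : 0 <= 1 - s / t by rewrite subr_ge0 ler_pdivrMr// mul1r.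
have -> : x + s *: y = (1 - s / t) *: x + (s / t) *: (x + t *: y).
  by rewrite scalerDr addrA -scalerDl subrK scale1r scalerA divfK// gt_eqF.
have := ler_normD ((1 - s / t) *: x) ((s / t) *: (x + t *: y)).
rewrite (normrZ (1 - s / t)) (normrZ (s / t)) (ger0_norm a0) (ger0_norm a1).
move=> le_s; rewrite ler_pdivrMr// lerBlDr.
apply: le_trans le_s _; rewrite le_eqVlt; apply/orP; left; apply/eqP.
by field; rewrite gt_eqF.
Qed.

Lemma diffquo_ge x y t : 0 < t -> - `|y| <= (`|x + t *: y| - `|x|) / t.
Proof.
move=> t0; rewrite ler_pdivlMr// mulNr lerBrDl lerBlDr.
have := ler_normB (x + t *: y) (t *: y).
by rewrite addrK normrZ gtr0_norm// mulrC.
Qed.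

Lemma rho_plus_cvg x y :
  (`|x + t *: y| - `|x|) / t @[t --> 0^'+] -->
  inf [set (`|x + t *: y| - `|x|) / t | t in [set` `]0, +oo[ ]].
Proof.
apply: (@nondecreasing_at_right_cvgr R _ 0 (BInfty R false)) => //.
  move=> s t; rewrite !in_itv/= !andbT => s0 _; exact: diffquo_le.
exists (- `|y|) => u [t /=]; rewrite in_itv/= andbT => t0 <-.
exact: diffquo_ge.
Qed.

(** The derivative is the infimum of the difference quotients, so the bound holds for every positive
    [t], not only for small ones. *)
Lemma rho_plus_le x y t : `|x| = 1 -> 0 < t ->
  1 + t * rho_plus x y <= `|x + t *: y|.
Proof.
move=> x1 t0; rewrite /rho_plus x1 mul1r -lerBrDl -ler_pdivlMl// mulrC.
have := rho_plus_cvg x y; rewrite x1 => /cvg_lim -> //.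
apply: ge_inf; last by exists t => //=; rewrite in_itv/= andbT.
exists (- `|y|) => u [s /=]; rewrite in_itv/= andbT => s0 <-; rewrite -x1.
exact: diffquo_ge.
Qed.

(** A limit at 0 only sees small [t]; [rho_plus_shift_ge] relies on this local form. *)
Lemma rho_plus_ge x y r e : `|x| = 1 -> 0 < e ->
  (forall t, 0 < t < e -> 1 + t * r <= `|x + t *: y|) -> r <= rho_plus x y.
Proof.
move=> x1 e0 H; rewrite /rho_plus x1 mul1r.
apply: limr_ge; first by have := rho_plus_cvg x y; rewrite x1 => /cvgP.
near=> t; rewrite ler_pdivlMr; last by near: t; exact: nbhs_right_gt.
rewrite lerBrDl mulrC; apply: H; apply/andP; split; near: t.
  exact: nbhs_right_gt.
exact: nbhs_right_lt.
Unshelve. all: by end_near. Qed.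

(** Replacing [t] by [- t] turns the left limit into a right one, so that later arguments can work
    with [rho_plus] alone. *)
Lemma rho_minusE x y : rho_minus x y = - rho_plus x (- y).
Proof.
rewrite /rho_minus /rho_plus -mulrN; congr (_ * _).
apply: cvg_lim => //; apply/cvg_at_leftNP; rewrite oppr0.
have -> : (fun t => (`|x + t *: y| - `|x|) / t) \o -%R =
          - (fun t => (`|x + t *: - y| - `|x|) / t) :> (R -> R).
  apply/funext => t /=; rewrite !fctE.
  by rewrite scalerN scaleNr invrN mulrN.
by have h := rho_plus_cvg x (- y); rewrite (cvg_lim _ h)//; exact: cvgN.
Qed.

Lemma rho_plus_le_norm x y : `|x| = 1 -> rho_plus x y <= `|y|.
Proof.
move=> x1; have := rho_plus_le x y 1 x1 ltr01.
have := ler_normD x (1 *: y).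
rewrite scale1r mul1r x1; lra.
Qed.

Lemma rho_plusZ_ge x y c : `|x| = 1 -> 0 < c ->
  c * rho_plus x y <= rho_plus x (c *: y).
Proof.
move=> x1 c0; apply: (rho_plus_ge _ _ _ 1) => // t /andP[t0 _].
by rewrite mulrA scalerA rho_plus_le// mulr_gt0.
Qed.

Lemma rho_plusZ x y c : `|x| = 1 -> 0 < c ->
  rho_plus x (c *: y) = c * rho_plus x y.
Proof.
move=> x1 c0; apply/eqP; rewrite eq_le rho_plusZ_ge// andbT.
have ci0 : 0 < c^-1 by rewrite invr_gt0.
have := rho_plusZ_ge x (c *: y) c^-1 x1 ci0.
by rewrite scalerA mulVf ?gt_eqF// scale1r mulrC ler_pdivrMr// mulrC.
Qed.

(** The factor [1 + t * s] is positive for [t < (1 + |s|)^-1]; pulling it out leaves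
    [x + (t / (1 + t * s)) *: y]. *)
Lemma rho_plus_shift_ge x y s : `|x| = 1 ->
  rho_plus x y + s <= rho_plus x (y + s *: x).
Proof.
move=> x1; have e0 : 0 < (1 + `|s|)^-1 by rewrite invr_gt0 ltr_pwDl.
apply: (rho_plus_ge _ _ _ _ x1 e0) => t /andP[t0 te].
have k0 : 0 < 1 + t * s.
  have : t * (1 + `|s|) < 1.
    by rewrite -[ltRHS](mulVf (lt0r_neq0 (ltr_pwDl ltr01 (normr_ge0 s))))
      ltr_pM2r// ltr_pwDl.
  have := ler_norm (- s); rewrite normrN => h; rewrite mulrDr mulr1.
  have : t * - s <= t * `|s| by rewrite ler_pM2l.
  lra.
have -> : x + t *: (y + s *: x) =
    (1 + t * s) *: (x + (t / (1 + t * s)) *: y).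
  rewrite !scalerDr !scalerA mulrCA divff ?gt_eqF// mulr1 scalerDl scale1r.
  by rewrite addrAC addrA addrC addrA addrAC.
rewrite normrZ gtr0_norm//.
have t'0 : 0 < t / (1 + t * s) by rewrite divr_gt0.
have := rho_plus_le x y _ x1 t'0; rewrite -(ler_pM2l k0); apply: le_trans.
rewrite le_eqVlt; apply/orP; left; apply/eqP.
by field; rewrite gt_eqF.
Qed.

Lemma rho_plus_shift x y s : `|x| = 1 ->
  rho_plus x (y + s *: x) = rho_plus x y + s.
Proof.
move=> x1; apply/eqP; rewrite eq_le rho_plus_shift_ge// andbT.
have := rho_plus_shift_ge x (y + s *: x) (- s) x1.
by rewrite scaleNr addrK lerBlDr.
Qed.

(** A convex function on the line is minimal at 0 exactly when it does not decrease initially in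
    either direction. *)
Lemma bj_orthogonalP x y : `|x| = 1 ->
  bj_orthogonal x y <-> 0 <= rho_plus x y /\ 0 <= rho_plus x (- y).
Proof.
move=> x1; split=> [xy|[p m] l].
  by split; apply: (rho_plus_ge _ _ _ 1) => // t _;
    rewrite mulr0 addr0 -[leLHS]x1 ?scalerN -?scaleNr; exact: xy.
have [l0|l0|<-] := ltgtP 0 l; last by rewrite scale0r addr0.
  have := rho_plus_le x y l x1 l0; rewrite x1; apply: le_trans.
  by rewrite lerDl mulr_ge0// ltW.
have nl0 : 0 < - l by rewrite oppr_gt0.
have := rho_plus_le x (- y) _ x1 nl0; rewrite x1 scalerN scaleNr opprK.
by apply: le_trans; rewrite lerDl mulr_ge0// ltW.
Qed.

End NormDerivatives.

(** * Coordinates and compactness of the unit ball in finite dimension *)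

Section FiniteDimension.
Context {R : realType} {X : normedModType R} {n : nat}.

Lemma linear_rV_continuous (f : {linear 'rV[R]_n -> X}) : continuous f.
Proof.
have fE : f = (fun v => \sum_(j < n) v 0 j *: f 'e_j) :> ('rV[R]_n -> X).
  apply/funext => v; rewrite [in LHS](row_sum_delta v) linear_sum.
  by apply: eq_bigr => j _; rewrite linearZ.
rewrite fE => v.
apply: (@cvg_big _ _ _ _ _ (@add_continuous X) _ (nbhs v) _ _ _ _) => j _.
by apply: cvgZr_tmp; exact: coord_continuous.
Qed.

(** The constant is the minimum of [|f v|] on the compact unit sphere, positive by injectivity;
    homogeneity extends the bound to all [v]. *)
Lemma linear_rV_norm_ge (f : {linear 'rV[R]_n -> X}) : injective f ->
  exists2 c : R, 0 < c & forall v, c * `|v| <= `|f v|.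
Proof.
move=> finj; pose S := [set v : 'rV[R]_n | `|v| = 1].
have Sc : compact S.
  apply: bounded_closed_compact.
    by exists 1; split => // M M1 v /= ->; exact: ltW.
  apply: (@preimage_closed _ _ (fun v : 'rV[R]_n => `|v|) [set x | x = 1]).
    by move=> v _; exact: norm_continuous.
  exact: closed_eq.
(* For [n = 0] the sphere is empty, all vectors vanish and any positive constant works. *)
have [S0|S0] := pselect (S !=set0); last first.
  exists 1 => // v; have [->|v0] := eqVneq v 0; first by rewrite normr0 mulr0.
  exfalso; apply: S0; exists (`|v|^-1 *: v).
  by rewrite /S /= normrZ normfV normr_id mulVf// normr_eq0.
have fc : {within S, continuous (fun v => `|f v|)}.
  apply: continuous_subspaceT => v; apply: continuous_comp.
    exact: linear_rV_continuous.
  exact: norm_continuous.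
have [u uS umin] := @EVT_min_rV R n (fun v => `|f v|) S S0 Sc fc.
move: uS; rewrite inE /S /= => u1.
exists `|f u|.
  rewrite normr_gt0; apply/eqP => fu0; have /finj u0 : f u = f 0.
    by rewrite fu0 linear0.
  by move: u1; rewrite u0 normr0 => /esym/eqP; rewrite oner_eq0.
move=> v; have [->|v0] := eqVneq v 0; first by rewrite normr0 mulr0.
rewrite -ler_pdivlMr ?normr_gt0//.
have vS : `|v|^-1 *: v \in S.
  by rewrite inE /S /= normrZ normfV normr_id mulVf// normr_eq0.
by apply: le_trans (umin _ vS) _; rewrite linearZ normrZ normfV normr_id mulrC.
Qed.

Lemma finite_dim_coordinates : Vector.axiom n X ->
  exists f : {linear X -> 'rV[R]_n},
    [/\ bijective f, continuous f & compact (@unit_ball R X)].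
Proof.
case=> f0 flin [g0 fK gK].
pose f : {linear X -> 'rV[R]_n} :=
  HB.pack f0 (GRing.isLinear.Build R X 'rV[R]_n *:%R f0 flin).
have glin : linear g0 by apply: (@can2_linear _ _ _ f).
pose g : {linear 'rV[R]_n -> X} :=
  HB.pack g0 (GRing.isLinear.Build R 'rV[R]_n X *:%R g0 glin).
have [c c0 cg] := linear_rV_norm_ge g (can_inj gK).
exists f; split; first by exists g0.
  apply/linear_bounded_continuous/linear_boundedP.
  exists c^-1; split; first by rewrite realE invr_ge0 ltW.
  move=> r /ltW cr x; apply: (@le_trans _ _ (c^-1 * `|x|)).
    by rewrite ler_pdivlMl// -[x in leRHS]fK; exact: cg.
  by rewrite ler_wpM2r.
(* The ball is the image under [g] of a closed set of row vectors bounded by [c^-1], where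
   Heine-Borel applies. *)
have -> : @unit_ball R X = g @` [set v | `|g v| <= 1].
  apply/seteqP; split=> [x x1|_ [v v1 <-]//].
  by exists (f x) => /=; rewrite fK.
apply: continuous_compact.
  by apply: continuous_subspaceT; exact: linear_rV_continuous.
apply: bounded_closed_compact.
  exists c^-1; split; first by rewrite realE invr_ge0 ltW.
  move=> r /ltW cr v /= v1; apply: le_trans cr.
  by rewrite -[leRHS]mulr1 ler_pdivlMl//; exact: le_trans v1.
apply: (@preimage_closed _ _ (fun v => `|g v|) [set x | x <= 1]).
  move=> v _; apply: continuous_comp; first exact: linear_rV_continuous.
  exact: norm_continuous.
exact: closed_le.
Qed.

End FiniteDimension.

(** * Extreme points in compact faces, and existence of orthogonal pairs *)

Section ExtremePoints.
Context {R : realType} {X : normedModType R} {n : nat}.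

(* The squared Euclidean norm of the coordinates is strictly convex, so a
   point of the face maximizing it is extreme. *)
Lemma compact_face_extreme (A C : set X) : Vector.axiom n X ->
  A !=set0 -> compact A -> A `<=` C ->
  (forall x y (t : R), C x -> C y -> 0 < t < 1 ->
    A (t *: x + (1 - t) *: y) -> A x /\ A y) ->
  exists2 z, A z & extreme_points C z.
Proof.
move=> /finite_dim_coordinates[f [fbij fc _]] A0 Ac AC face.
pose q x := \sum_(j < n) f x 0 j ^+ 2.
have qc : continuous q.
  move=> x; apply: (@cvg_big _ _ _ _ _ (@add_continuous R) _ (nbhs x) _ _ _ _).
  move=> j _; apply: (cvg_comp f (fun v : 'rV[R]_n => v 0 j ^+ 2) (fc x)).
  rewrite /=; apply: cvgM; exact: coord_continuous.
(* This identity quantifies strict convexity; at the maximizer [z] it forces [q (x - y) <= 0]. *)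
have qE x y t : q (t *: x + (1 - t) *: y) =
    t * q x + (1 - t) * q y - t * (1 - t) * q (x - y).
  rewrite /q !mulr_sumr -big_split -sumrB; apply: eq_bigr => j _.
  by rewrite [in LHS]linearD ![in LHS]linearZ linearB !mxE/=; ring.
have [z zA zmax] := @compact_EVT_max _ R q A A0 Ac (continuous_subspaceT qc).
rewrite inE in zA; exists z => //; split; first exact: AC.
move=> x y t Cx Cy t01 zE.
have [Ax Ay] : A x /\ A y by apply: (face _ _ t) => //; rewrite -zE.
have qx : q x <= q z by apply: zmax; rewrite inE.
have qy : q y <= q z by apply: zmax; rewrite inE.
have xy : x = y.
  apply/eqP; rewrite -subr_eq0; apply/eqP/(bij_inj fbij)/rowP => j.
  rewrite linear0 mxE; apply/eqP; rewrite -sqrf_eq0 eq_le sqr_ge0 andbT.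
  apply: (@le_trans _ _ (q (x - y))).
    by rewrite /q (bigD1 j)//= lerDl sumr_ge0// => i _; exact: sqr_ge0.
  move/andP: t01 => [t0 t1]; have t1' : 0 < 1 - t by rewrite subr_gt0.
  have tt : 0 < t * (1 - t) by exact: mulr_gt0.
  rewrite -(ler_pM2l tt) mulr0.
  have := ler_wpM2l (ltW t0) qx; have := ler_wpM2l (ltW t1') qy.
  by have := qE x y t; rewrite -zE; lra.
have zx : z = x by rewrite zE -xy -scalerDl subrKC scale1r.
by rewrite -xy zx.
Qed.

(** For independent [u] and [v], the point of least norm on the line [u + l *: v] is orthogonal to
    [v]; it remains to normalize both. *)
Lemma bj_orthogonal_exists : (2 <= n)%N -> Vector.axiom n X ->
  exists x y : X, [/\ unit_sphere x, unit_sphere y & bj_orthogonal x y].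
Proof.
move=> n2 /finite_dim_coordinates[f [[g fK gK] _ _]].
pose i0 := Ordinal (ltnW n2); pose i1 := Ordinal n2.
pose u := g 'e_i0; pose v := g 'e_i1.
have fN0 x j : f x 0 j != 0 -> 0 < `|x|.
  move=> fx0; rewrite normr_gt0; apply: contraNneq fx0 => ->.
  by rewrite linear0 mxE.
have v0 : 0 < `|v| by apply: (fN0 _ i1); rewrite gK !mxE/= oner_neq0.
have uv0 l : 0 < `|u + l *: v|.
  apply: (fN0 _ i0); rewrite linearD linearZ/= !gK !mxE/= mulr0 addr0.
  exact: oner_neq0.
pose h l := `|u + l *: v|.
have hc : continuous h.
  move=> l; apply: (cvg_comp (fun l => u + l *: v) Num.norm); last first.
    exact: norm_continuous.
  by apply: cvgD; [exact: cvg_cst | apply: cvgZr_tmp; exact: cvg_id].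
(* Beyond [M] one has [h l >= |l| * |v| - |u| > |u| = h 0], so a minimum over [[- M, M]] is
   global. *)
pose M := 2 * `|u| / `|v|.
have M0 : 0 <= M by rewrite divr_ge0 ?mulr_ge0.
have MM : - M <= M by lra.
have [c cM cmin] := EVT_min MM (continuous_subspaceT hc).
have {}cmin l : h c <= h l.
  have [lM|lM] := boolP (l \in `[- M, M]%R); first exact: cmin.
  have : h c <= h 0 by apply: cmin; rewrite in_itv/=; lra.
  rewrite {2}/h scale0r addr0 => /le_trans; apply.
  have {}lM : M < `|l| by move: lM; rewrite in_itv/= -ler_norml -ltNge.
  have := ler_normB (u + l *: v) u.
  rewrite addrAC subrr add0r normrZ.
  by move: lM; rewrite /M ltr_pdivrMr// /h; lra.
pose x := u + c *: v; have x0 : 0 < `|x| by exact: uv0.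
exists (`|x|^-1 *: x), (`|v|^-1 *: v); split => [| |l].
- by rewrite /unit_sphere /= normrZ normfV normr_id mulVf// gt_eqF.
- by rewrite /unit_sphere /= normrZ normfV normr_id mulVf// gt_eqF.
rewrite scalerA.
have -> : `|x|^-1 *: x + (l / `|v|) *: v =
    `|x|^-1 *: (u + (c + `|x| * (l / `|v|)) *: v).
  rewrite (scalerDl v c) addrA -/x [RHS]scalerDr [in RHS]scalerA.
  by rewrite mulKf// gt_eqF.
rewrite !normrZ; apply: ler_wpM2l; first exact: normr_ge0.
exact: cmin.
Qed.

End ExtremePoints.

(** * The largest right derivative over orthogonal pairs, and the bounds on [rho] *)

Section SteepDirections.
Context {R : realType} {X : normedModType R}.
Implicit Types (x y z u v w : X) (r s t : R).

(** The case [s = 0] is included on purpose: it gives [1 <= |x|], so points of the ball with this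
    property are unit vectors. *)
Definition steep x y r := forall s, 0 <= s -> 1 + s * r <= `|x + s *: y|.

Lemma steepP x y r : `|x| = 1 -> steep x y r <-> r <= rho_plus x y.
Proof.
move=> x1; split=> [H|ry s].
  by apply: (rho_plus_ge _ _ _ 1) => // t /andP[t0 _]; apply: H; exact: ltW.
rewrite le_eqVlt => /predU1P[<-|s0].
  by rewrite mul0r scale0r !addr0 x1.
apply: le_trans (rho_plus_le _ y _ x1 s0).
by rewrite lerD2l ler_pM2l.
Qed.

Lemma steep_norm x y r : steep x y r -> unit_ball x -> `|x| = 1.
Proof.
move=> /(_ 0 (lexx 0)); rewrite mul0r scale0r !addr0 => x1 Bx.
by apply/eqP; rewrite eq_le x1 andbT.
Qed.

(** Testing at [t * s] puts the whole displacement on [u]; the term in [v] contributes at most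
    [1 - t], which cancels before dividing by [t]. *)
Lemma steep_face u v t y r : 0 < t < 1 -> unit_ball v ->
  steep (t *: u + (1 - t) *: v) y r -> steep u y r.
Proof.
move=> /andP[t0 t1] v1 H s s0.
have {H} := H _ (mulr_ge0 (ltW t0) s0).
have -> : t *: u + (1 - t) *: v + (t * s) *: y =
    t *: (u + s *: y) + (1 - t) *: v.
  by rewrite scalerDr scalerA addrAC.
have := ler_normD (t *: (u + s *: y)) ((1 - t) *: v).
have t1' : 0 <= 1 - t by rewrite subr_ge0 ltW.
rewrite (normrZ t) (normrZ (1 - t)) (gtr0_norm t0) (ger0_norm t1') => le1 le2.
have : (1 - t) * `|v| <= 1 - t by rewrite ler_piMr.
by move=> le3; rewrite -(ler_pM2l t0); lra.
Qed.

Lemma steep_closed (T : topologicalType) (f g : T -> X) (h : T -> R) :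
  continuous f -> continuous g -> continuous h ->
  closed [set p | steep (f p) (g p) (h p)].
Proof.
move=> fc gc hc.
have -> : [set p | steep (f p) (g p) (h p)] = \bigcap_(s in [set s | 0 <= s])
    ((fun p => `|f p + s *: g p| - (1 + s * h p)) @^-1` [set a : R | 0 <= a]).
  apply/seteqP; split=> p /= H s /= s0; first by rewrite subr_ge0; exact: H.
  by rewrite -subr_ge0; exact: (H s).
apply: closed_bigI => s _; apply: preimage_closed; last exact: closed_ge.
move=> p _; apply: cvgB.
  apply: (cvg_comp (fun p => f p + s *: g p) Num.norm); last first.
    exact: norm_continuous.
  by apply: cvgD; [exact: fc | apply: cvgZl_tmp; exact: gc].
by apply: cvgD; [exact: cvg_cst | apply: cvgM; [exact: cvg_cst|exact: hc]].
Qed.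

Lemma unit_sphere_closed : closed (@unit_sphere R X).
Proof.
apply: (@preimage_closed _ _ (fun v : X => `|v|) [set x | x = 1]).
  by move=> v _; exact: norm_continuous.
exact: closed_eq.
Qed.

Lemma bj_orthogonalN x y : bj_orthogonal x y -> bj_orthogonal x (- y).
Proof. by move=> xy l; rewrite scalerN -scaleNr. Qed.

(** First [r] is maximized over a compact set of triples; then, with [y] and [r] kept fixed, the
    base point moves to an extreme point. *)
Lemma exists_steepest_extreme (n : nat) : (2 <= n)%N -> Vector.axiom n X ->
  exists z y r, [/\ extreme_points (@unit_ball R X) z, `|z| = 1, unit_sphere y,
    bj_orthogonal z y & r <= rho_plus z y /\
    forall x w, unit_sphere x -> unit_sphere w -> bj_orthogonal x w ->
      rho_plus x w <= r].
Proof.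
move=> n2 hX; have [f [_ _ Bc]] := finite_dim_coordinates hX.
have Sc : compact (@unit_sphere R X).
  apply: subclosed_compact unit_sphere_closed Bc _ => x x1.
  by rewrite /unit_ball/= x1.
(* Orthogonality is encoded by closed conditions: [0 <= r] covers the direction [y], steepness 0
   covers [- y]. The bound [r <= 1] gives compactness. *)
pose T : set (X * X * R) :=
  [set p | unit_sphere p.1.1 /\ unit_sphere p.1.2 /\ p.2 \in `[0, 1] /\
    steep p.1.1 p.1.2 p.2 /\ steep p.1.1 (- p.1.2) 0].
have Tc : compact T.
  have -> : T = (unit_sphere (X := X) `*` unit_sphere (X := X) `*` `[0, 1]) `&`
      ([set p | steep p.1.1 p.1.2 p.2] `&` [set p | steep p.1.1 (- p.1.2) 0]).
    by apply/seteqP; split=> -[[x y] r]; rewrite /T/=; tauto.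
  apply: compact_closedI.
    apply: compact_setX; first exact: compact_setX.
    exact: segment_compact.
  have c1 : continuous (fun p : X * X * R => p.1.1).
    by move=> p; apply: (@cvg_comp _ _ _ fst fst); exact: cvg_fst.
  have c2 : continuous (fun p : X * X * R => p.1.2).
    move=> p; apply: (@cvg_comp _ _ _ fst snd); first exact: cvg_fst.
    exact: cvg_snd.
  apply: closedI; apply: steep_closed => // p; first exact: cvg_snd.
    by apply: cvgN; exact: c2.
  exact: cvg_cst.
have TI x w : unit_sphere x -> unit_sphere w -> bj_orthogonal x w ->
    T (x, w, rho_plus x w).
  move=> x1 w1 /(bj_orthogonalP _ _ x1)[p m].
  do 2?split => //; split; last by split; apply/steepP.
  by rewrite in_itv/= p/= -w1 rho_plus_le_norm.
have T0 : T !=set0.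
  have [x [w [x1 w1 xw]]] := bj_orthogonal_exists n2 hX.
  by exists (x, w, rho_plus x w); exact: TI.
have sc : {within T, continuous (fun p => p.2)}.
  by apply: continuous_subspaceT => p; exact: cvg_snd.
have [[[x y] r]] := compact_EVT_max T0 Tc sc.
rewrite inE => -[/= x1 [y1 [/[!in_itv]/= /andP[r0 _] [xy xNy]]]] rmax.
(* By [steep_face] this is a face of the ball; it contains [x]. *)
pose A : set X := unit_ball (X := X) `&`
  ([set z | steep z y r] `&` [set z | steep z (- y) 0]).
have [z [/= Bz [zy zNy]] zext] :
    exists2 z, A z & extreme_points (@unit_ball R X) z.
  apply: (compact_face_extreme _ _ hX).
  - by exists x; split => //; rewrite /unit_ball/= x1.
  - apply: compact_closedI => //.
    by apply: closedI; apply: steep_closed => p;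
      try exact: cvg_cst; exact: cvg_id.
  - by move=> ? [].
  move=> u v t u1 v1 t01 [_ [H1 H2]].
  (* [steep_face] concerns the first end point, so [v] is treated by exchanging [t] and [1 - t]. *)
  have t01' : 0 < 1 - t < 1 by move: t01 => /andP[]; lra.
  split; split => //; split; try exact: steep_face t01 v1 _.
    by apply: (steep_face v u _ _ _ t01' u1); rewrite subKr addrC.
  by apply: (steep_face v u _ _ _ t01' u1); rewrite subKr addrC.
have z1 := steep_norm _ _ _ zy Bz.
exists z, y, r; split => //.
  apply/(bj_orthogonalP _ _ z1); split; last exact/steepP.
  by apply: le_trans r0 _; exact/steepP.
split; first exact/steepP.
by move=> u w u1 w1 uw; apply: (rmax (u, w, _)); rewrite inE; exact: TI.
Qed.

(* Adding to [y] the multiple of [x] that makes the left derivative vanish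
   costs at most a factor [1 + b] in norm, where [b = - rho_minus x y]; since
   [rho_plus x y <= 1], this is outweighed by the gain in [rho_plus]. *)
Lemma rho_ge_half x y : `|x| = 1 -> unit_sphere y -> bj_orthogonal x y ->
  exists w, [/\ unit_sphere w, bj_orthogonal x w & rho_plus x y / 2 <= rho x w].
Proof.
move=> x1 y1 xy; have [a0 b0] := (bj_orthogonalP _ _ x1).1 xy.
set a := rho_plus x y in a0 *; pose b := rho_plus x (- y); rewrite -/b in b0.
have a1 : a <= 1 by rewrite -[leRHS]y1; exact: rho_plus_le_norm.
pose v := y + b *: x; pose k := `|v|.
have k0 : 0 < k.
  (* If [v] vanished, comparing norms would give [b = 1] and [y = - x], which is not orthogonal to
     [x]. *)
  rewrite /k normr_gt0; apply/negP => /eqP v0.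
  have yE : y = - (b *: x) by apply/eqP; rewrite -addr_eq0; exact/eqP.
  have bE : b = 1.
    by rewrite -(ger0_norm b0) -[RHS]y1 yE normrN (normrZ b x) x1 mulr1.
  by have := xy 1; rewrite yE bE !scale1r subrr normr0 x1 ler10.
have kb : k <= 1 + b.
  by have := ler_normD y (b *: x); rewrite (normrZ b x) x1 y1 mulr1 ger0_norm.
have ki0 : 0 < k^-1 by rewrite invr_gt0.
have pw : rho_plus x (k^-1 *: v) = (a + b) / k.
  by rewrite rho_plusZ// rho_plus_shift// mulrC.
have mw : rho_plus x (- (k^-1 *: v)) = 0.
  by rewrite -scalerN rho_plusZ// opprD -scaleNr rho_plus_shift// subrr mulr0.
exists (k^-1 *: v); split.
- by rewrite /unit_sphere/= normrZ gtr0_norm// mulVf// gt_eqF.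
- by apply/bj_orthogonalP => //; rewrite pw mw divr_ge0 ?addr_ge0// ltW.
rewrite /rho rho_minusE pw mw oppr0 addr0 ler_pM2r ?invr_gt0// ler_pdivlMr//.
have : a * k <= a * (1 + b) by rewrite ler_wpM2l.
have : a * b <= b by rewrite ler_piMl.
lra.
Qed.

(** [rho] averages [rho_plus] in [[0, r]] and [rho_minus] in [[- r, 0]]. *)
Lemma rho_le_half x y r : `|x| = 1 -> bj_orthogonal x y ->
  rho_plus x y <= r -> rho_plus x (- y) <= r -> `|rho x y| <= r / 2.
Proof.
move=> x1 xy; have [] := (bj_orthogonalP _ _ x1).1 xy.
by rewrite ler_norml /rho rho_minusE; lra.
Qed.

End SteepDirections.

(** * Attainment of the supremum at an extreme point *)

Theorem theorem2p4 (R : realType) (n : nat) (X : completeNormedModType R)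
    (hn : (2 <= n)%N) (hX : Vector.axiom n X) :
  exists z : X, extreme_points (unit_ball (X := X)) z /\
    exists w : X, [/\ unit_sphere w, bj_orthogonal z w & Gamma X = rho z w].
Proof.
have [z [y [r [zext z1 y1 zy [ry rmax]]]]] := exists_steepest_extreme n hn hX.
have [w [w1 zw zwr]] := rho_ge_half z y z1 y1 zy.
exists z; split => //; exists w; split => //.
have ub (x v : X) : unit_sphere x -> unit_sphere v -> bj_orthogonal x v ->
    `|rho x v| <= rho z w.
  move=> x1 v1 xv; apply: (@le_trans _ _ (r / 2)); last first.
    by apply: le_trans zwr; rewrite ler_pM2r// invr_gt0.
  (* Maximality of [r] is also applied to [- v], to bound the left derivative. *)
  have vN : unit_sphere (- v) by rewrite /unit_sphere/= normrN.
  by apply: (rho_le_half _ _ _ x1 xv); apply: rmax => //; exact: bj_orthogonalN.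
(* [ub] bounds the supremum above by [rho z w]; the pair [(z, w)] itself gives the other
   inequality. *)
apply/eqP; rewrite eq_le; apply/andP; split.
  apply: ge_sup => [|_ [x [v [x1 v1 xv ->]]]]; last exact: ub.
  by exists `|rho z w|, z, w.
apply: le_trans (ler_norm _) _; apply: ub_le_sup; last by exists z, w.
by exists (rho z w) => _ [x [v [x1 v1 xv ->]]]; exact: ub.
Qed.
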